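(* Let $b>0$. The space $L^{\infty}_{1/b}(\ell_2)$ is a Banach algebra under pointwise multiplication.
   Context: For $b>0$, $L^{\infty}_{1/b}(\ell_2)$ denotes the set of measurable functions $f:\mathbb R\to\mathbb C$ (identified when equal a.e.) for which the norm defined by $$\|f\|^2_{L^{\infty}_{1/b}(\ell_2)}=\operatorname*{ess\,sup}_{x\in[0,1/b]}\ \sum_{k\in\mathbb Z}\left|f\left(x-\tfrac{k}{b}\right)\right|^2$$ is finite. A Banach algebra is not required to have an identity. *)

(* Defs.v *)
From HB Require Import structures.
From mathcomp Require Import all_boot all_order all_algebra complex.
From mathcomp Require Import all_classical all_reals all_analysis.
From mathcomp Require Import measurable_realfun ess_sup_inf.

Set Implicit Arguments.
Unset Strict Implicit.
Unset Printing Implicit Defensive.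

Import Order.TTheory GRing.Theory Num.Theory.
Import numFieldNormedType.Exports.

Local Open Scope classical_set_scope.
Local Open Scope ring_scope.
Local Open Scope complex_scope.
Local Open Scope quotient_scope.

(* Associativity, bilinearity and submultiplicativity of the norm only: there
   is no unit. *)
HB.mixin Record CompleteNormedModule_isBanachAlgebra (K : numFieldType) A
    & CompleteNormedModule K A := {
  bmul : A -> A -> A ;
  bmulA : associative bmul ;
  bmulDl : left_distributive bmul +%R ;
  bmulDr : right_distributive bmul +%R ;
  bscalerAl : forall (a : K) (u v : A), a *: bmul u v = bmul (a *: u) v ;
  bscalerAr : forall (a : K) (u v : A), a *: bmul u v = bmul u (a *: v) ;
  ler_normbM : forall u v : A, `|bmul u v| <= `|u| * `|v|
}.

#[short(type="banachAlgType")]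
HB.structure Definition BanachAlgebra (K : numFieldType) :=
  {A of CompleteNormedModule K A & CompleteNormedModule_isBanachAlgebra K A}.

(* The Lebesgue sigma-algebra on R; the sigma-algebra carried by
   lebesgue_measure is only the Borel one. *)
Definition lebesgueTypeR (R : realType) : Type :=
  g_sigma_algebraType (completed_algebra_gen (@lebesgue_measure R)).
HB.instance Definition _ (R : realType) := Measurable.on (lebesgueTypeR R).

Definition cmeasurable (R : realType) (f : R -> R[i]) : Prop :=
  measurable_fun [set: lebesgueTypeR R]
    ((fun x => complex.Re (f x)) : lebesgueTypeR R -> R) /\
  measurable_fun [set: lebesgueTypeR R]
    ((fun x => complex.Im (f x)) : lebesgueTypeR R -> R).

Section amalgam.
Context {R : realType} (b : R).

Definition amalgam_normsq (f : R -> R[i]) : \bar R :=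
  ess_sup (mrestr lebesgue_measure (measurable_itv `[0, b^-1]))
    (fun x => \esum_(k in [set: int])
       (ComplexField.Normc.normc (f (x - k%:~R / b)) ^+ 2)%:E)%E.

Definition amalgam_norm (f : R -> R[i]) : R :=
  Num.sqrt (fine (amalgam_normsq f)).

(* For b > 0 the interval has positive measure, so amalgam_normsq f >= 0 and
   the strict bound is finiteness of the norm. *)
Definition amalgam_set : set (R -> R[i]) :=
  [set f | cmeasurable f /\ (amalgam_normsq f < +oo)%E].

Definition amalgam_fun : Type := {f : R -> R[i] | f \in amalgam_set}.
HB.instance Definition _ := Choice.on amalgam_fun.

Definition amalgam_ae_eq (f g : amalgam_fun) : bool :=
  `[< val f = val g %[ae lebesgue_measure] >].

Let amalgam_ae_eq_refl : reflexive amalgam_ae_eq.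
Proof. by move=> f; apply/asboolP; exact: ae_eq_refl. Qed.

Let amalgam_ae_eq_sym : symmetric amalgam_ae_eq.
Proof. by move=> f g; apply/idP/idP => /asboolP h; apply/asboolP/ae_eq_sym. Qed.

Let amalgam_ae_eq_trans : transitive amalgam_ae_eq.
Proof. by move=> f g h /asboolP gf /asboolP fh; apply/asboolP/(ae_eq_trans gf fh). Qed.

Canonical amalgam_ae_eq_equiv :=
  EquivRel amalgam_ae_eq amalgam_ae_eq_refl amalgam_ae_eq_sym
    amalgam_ae_eq_trans.

(* L^oo_{1/b}(l_2) *)
Definition amalgam : Type := {eq_quot amalgam_ae_eq}.
HB.instance Definition _ := Choice.on amalgam.
HB.instance Definition _ := EqQuotient.on amalgam.

End amalgam.
Arguments amalgam_fun {R} b.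
Arguments amalgam {R} b.

(* Main.v *)
Require Import Defs.
From HB Require Import structures.
From mathcomp Require Import all_boot all_order all_algebra complex.
From mathcomp Require Import all_classical all_reals all_analysis.
From mathcomp Require Import measurable_realfun ess_sup_inf ring lra.

(** Write [S f x] for the sum of [|f (x - k/b)|^2] over [k], which is
    [1/b]-periodic in [x].  Since Lebesgue null sets are translation invariant
    and the translates of [[0, 1/b]] by multiples of [1/b] cover the line,
    [||f|| <= s] holds iff [S f <= s^2] almost everywhere on the line.  The
    norm inequalities, including [||f g|| <= ||f|| ||g||], thereby reduce to
    inequalities in [l^2(Z)] at almost every [x].  For completeness, a sequence
    with [||u m - u n|| <= 2^-n] for [n <= m] is Cauchy at almost every point;
    the real and imaginary limsups give a limit that is measurable everywhere,
    and the [l^2] bounds pass to it pointwise. *)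

Set Implicit Arguments.
Unset Strict Implicit.
Unset Printing Implicit Defensive.

Import Order.TTheory GRing.Theory Num.Theory.
Import numFieldNormedType.Exports.

Local Open Scope classical_set_scope.
Local Open Scope ring_scope.
Local Open Scope complex_scope.
Local Open Scope quotient_scope.

Local Notation normc := ComplexField.Normc.normc.

Lemma normc_ge0 {R : realType} (z : R[i]) : 0 <= normc z.
Proof. by case: z => x y; exact: sqrtr_ge0. Qed.

Lemma ler_fsum {R : realType} {I : choiceType} (F : set I) (a b : I -> R) :
  finite_set F -> (forall i, a i <= b i) ->
  \sum_(i \in F) a i <= \sum_(i \in F) b i.
Proof. by move=> finF ab; rewrite !fsbig_finite//=; exact: ler_sum. Qed.

(** * Inequalities for square sums over an arbitrary index set *)

Section l2_sum.
Context {R : realType} {I : choiceType}.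
Implicit Types (u v : I -> R[i]) (s t c : R).

Definition l2sq u : \bar R := (\esum_(k in [set: I]) (normc (u k) ^+ 2)%:E)%E.

(** A sum of nonnegative terms is the supremum of its finite partial sums. The estimates below
    thereby become estimates of finite real sums. *)
Lemma l2sqP u c : (l2sq u <= c%:E)%E <->
  forall F : set I, finite_set F -> \sum_(k \in F) normc (u k) ^+ 2 <= c.
Proof.
split=> [uc F finF|uc].
  rewrite -lee_fin -fsumEFin//; apply: le_trans uc.
  by apply: ereal_sup_ubound; exists F.
apply: ge_ereal_sup => _ [F [finF _] <-].
by rewrite fsumEFin// lee_fin uc.
Qed.

Lemma l2sq_normc u s k :
  0 <= s -> (l2sq u <= (s ^+ 2)%:E)%E -> normc (u k) <= s.
Proof.
move=> s0 /l2sqP /(_ [set k] (finite_set1 k)).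
by rewrite fsbig_set1 ler_pXn2r// nnegrE ?normc_ge0.
Qed.

(** Minkowski's inequality in terms of bounds instead of norms. Young's inequality with weights
    [t / s] and [s / t] is summed over [F], and these weights are the ones for which [(1 + t / s) *
    s ^+ 2 + (1 + s / t) * t ^+ 2] equals [(s + t) ^+ 2]. *)
Lemma l2sqD u v s t : 0 < s -> 0 < t ->
  (l2sq u <= (s ^+ 2)%:E -> l2sq v <= (t ^+ 2)%:E ->
   l2sq (fun k => (u k + v k)%R) <= ((s + t) ^+ 2)%R%:E)%E.
Proof.
move=> s0 t0 /l2sqP us /l2sqP vt; apply/l2sqP => F finF.
have st : s != 0 /\ t != 0 by rewrite !gt_eqF.
(* Young's inequality [2 x y <= (t / s) x^2 + (s / t) y^2] *)
have young k : normc (u k + v k) ^+ 2 <=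
    (1 + t / s) * normc (u k) ^+ 2 + (1 + s / t) * normc (v k) ^+ 2.
  set x := normc (u k); set y := normc (v k).
  apply: (@le_trans _ _ ((x + y) ^+ 2)).
    by rewrite ler_pXn2r ?nnegrE ?addr_ge0 ?normc_ge0 ?le_normcD.
  rewrite -subr_ge0 (_ : _ - _ = (t * x - s * y) ^+ 2 / (s * t)).
    by rewrite divr_ge0 ?sqr_ge0// mulr_ge0// ltW.
  by field; case: st => -> ->.
apply: (@le_trans _ _ ((1 + t / s) * s ^+ 2 + (1 + s / t) * t ^+ 2)); last first.
  by rewrite le_eqVlt; apply/orP; left; apply/eqP; field; case: st => -> ->.
apply: (@le_trans _ _ (\sum_(k \in F) ((1 + t / s) * normc (u k) ^+ 2 +
    (1 + s / t) * normc (v k) ^+ 2))).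
  by apply: ler_fsum => // k; exact: young.
rewrite fsbig_split//= -!mulr_fsumr; apply: lerD.
  by rewrite ler_wpM2l ?us// addr_ge0// divr_ge0// ltW.
by rewrite ler_wpM2l ?vt// addr_ge0// divr_ge0// ltW.
Qed.

Lemma l2sqZ u (a : R[i]) s :
  (l2sq u <= (s ^+ 2)%:E ->
   l2sq (fun k => (a * u k)%R) <= ((normc a * s) ^+ 2)%R%:E)%E.
Proof.
move=> /l2sqP us; apply/l2sqP => F finF.
under eq_fsbigr do rewrite ComplexField.Normc.normcM exprMn.
by rewrite -mulr_fsumr exprMn ler_wpM2l ?sqr_ge0// us.
Qed.

(** Every coordinate of [u] is at most [s] in modulus, since l^2 embeds in l^oo. So the product is
    dominated termwise by [s] times [v]. *)
Lemma l2sqM u v s t : 0 <= s ->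
  (l2sq u <= (s ^+ 2)%:E -> l2sq v <= (t ^+ 2)%:E ->
   l2sq (fun k => (u k * v k)%R) <= ((s * t) ^+ 2)%R%:E)%E.
Proof.
move=> s0 us /l2sqP vt; apply/l2sqP => F finF.
apply: (@le_trans _ _ (\sum_(k \in F) s ^+ 2 * normc (v k) ^+ 2)).
  apply: ler_fsum => // k.
  rewrite ComplexField.Normc.normcM exprMn ler_wpM2r ?sqr_ge0//.
  by rewrite ler_pXn2r ?nnegrE ?normc_ge0// l2sq_normc.
by rewrite -mulr_fsumr exprMn ler_wpM2l ?sqr_ge0// vt.
Qed.

(** Lower semicontinuity under coordinatewise convergence: a finite partial sum depends continuously
    on finitely many coordinates, and the half-line of reals at most [c] is closed. *)
Lemma l2sq_lim (u_ : nat -> I -> R[i]) u c :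
  (forall k, complex.Re (u_ n k) @[n --> \oo] --> complex.Re (u k)) ->
  (forall k, complex.Im (u_ n k) @[n --> \oo] --> complex.Im (u k)) ->
  (\forall n \near \oo, (l2sq (u_ n) <= c%:E)%E) -> (l2sq u <= c%:E)%E.
Proof.
move=> cRe cIm uc; apply/l2sqP => F finF.
have normcE (z : R[i]) : normc z ^+ 2 = complex.Re z ^+ 2 + complex.Im z ^+ 2.
  by case: z => x y; rewrite /= sqr_sqrtr// addr_ge0 ?sqr_ge0.
have : \sum_(k \in F) normc (u_ n k) ^+ 2 @[n --> \oo] -->
    \sum_(k \in F) normc (u k) ^+ 2.
  rewrite fsbig_finite//=; under eq_fun do rewrite fsbig_finite//=.
  apply: cvg_big; [exact: add_continuous|move=> k _].
  rewrite normcE; under eq_fun do rewrite normcE !expr2.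
  by rewrite !expr2; apply: cvgD; apply: cvgM.
move=> cu; apply: (closed_cvg (fun y => y <= c) (@closed_le _ c) _ _ cu).
by apply: filterS uc => n /l2sqP; exact.
Qed.

End l2_sum.

(** * Null sets, translations and periodicity *)

Section translation.
Context {R : realType}.
Local Notation mu := (@lebesgue_measure R).
Implicit Types (P Q S : R -> Prop) (b : R).

Lemma measurable_shift a : measurable_fun [set: measurableTypeR R]
  (shift a : measurableTypeR R -> measurableTypeR R).
Proof. by apply: measurable_funD => //; exact: measurable_cst. Qed.

(** By uniqueness of Lebesgue measure, it is enough that its pushforward under the shift gives
    half-open intervals their length. *)
Lemma lebesgue_measure_shift a (A : set R) : measurable A ->
  mu (shift a @^-1` A) = mu A.
Proof.
have mshift := measurable_shift a.
move=> mA; apply/esym; apply: (@lebesgue_measure_unique R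
  (pushforward mu (shift a : _ -> measurableTypeR R))) => // _ [[x y] _ <-].
rewrite /= /pushforward.
have -> : shift a @^-1` `]x, y]%classic = `]x - a, y - a]%classic.
  by apply/seteqP; split => z /=; rewrite !in_itv/= ltrBlDr lerBrDr.
rewrite !lebesgue_measure_itv/= !lte_fin ltrD2r.
by case: ifP => // _; rewrite -!EFinD; congr EFin; ring.
Qed.

Lemma ae_shift a P : {ae mu, forall x, P x} -> {ae mu, forall x, P (x + a)}.
Proof.
move=> [N [mN N0 PN]]; exists (shift a @^-1` N); split => /=.
- by rewrite -[X in measurable X]setTI; exact: measurable_shift.
- by rewrite -N0; exact: lebesgue_measure_shift.
- by move=> x nPx; exact: PN.
Qed.

Lemma ae_imply P Q : (forall x, P x -> Q x) ->
  {ae mu, forall x, P x} -> {ae mu, forall x, Q x}.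
Proof.
by move=> PQ; apply: (@filterS _ (nbhs (almost_everywhere mu))).
Qed.

Lemma ae_imply2 P Q S : (forall x, P x -> Q x -> S x) ->
  {ae mu, forall x, P x} -> {ae mu, forall x, Q x} -> {ae mu, forall x, S x}.
Proof.
move=> PQS; apply: (@filterS2 _ (nbhs (almost_everywhere mu))) => x.
exact: PQS.
Qed.

(** The integers are enumerated by [unpickle], so this is a countable intersection; a natural number
    that codes no integer gives a vacuous condition. *)
Lemma ae_forall_int (P : int -> R -> Prop) :
  (forall k, {ae mu, forall x, P k x}) -> {ae mu, forall x, forall k, P k x}.
Proof.
move=> aeP; have : {ae mu, forall x, forall n,
    forall k, unpickle n = Some k -> P k x}.
  apply: ae_foralln => n; case: (unpickle n) => [k|]; last exact: aeW.
  by apply: ae_imply (aeP k) => x Pkx _ [<-].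
by apply: ae_imply => x Px k; apply: (Px (pickle k)); rewrite pickleK.
Qed.

Lemma ae_shifts b P : {ae mu, forall x, P x} ->
  {ae mu, forall x, forall k : int, P (x - k%:~R / b)}.
Proof. by move=> aeP; apply: ae_forall_int => k; exact: ae_shift. Qed.

Lemma ae_periodic b P : 0 < b ->
  (forall x (k : int), P (x - k%:~R / b) -> P x) ->
  {ae mrestr mu (measurable_itv `[0, b^-1]), forall x, P x} ->
  {ae mu, forall x, P x}.
Proof.
move=> b0 perP [N [mN N0 PN]].
(* A null set of the restricted measure meets the interval in a Lebesgue null set; off the interval
   the implication is vacuous. *)
have : {ae mu, forall x, `[0, b^-1]%classic x -> P x}.
  exists (N `&` `[0, b^-1]); split => //; first exact: measurableI.
  by move=> x /= /not_implyP[xb nPx]; split => //; exact: PN.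
move=> /(ae_shifts b); apply: ae_imply => x Px.
(* Subtracting [k / b] with [k] the floor of [x * b] brings [x] into the interval. *)
apply: (perP x (Num.floor (x * b))); apply: Px => /=; rewrite in_itv/=.
rewrite subr_ge0 ler_pdivrMr// floor_le/= -(ler_pM2r b0) mulrBl.
rewrite divfK ?mulVf ?gt_eqF// lerBlDr.
by rewrite addrC ltW// -intrD1 floorD1_gt.
Qed.

Lemma ae_restr b P : {ae mu, forall x, P x} ->
  {ae mrestr mu (measurable_itv `[0, b^-1]), forall x, P x}.
Proof.
move=> [N [mN N0 PN]]; exists N; split => //.
by rewrite /mrestr; apply: (subset_measure0 _ mN) => //; exact: measurableI.
Qed.

End translation.

(** * Measurability of complex-valued functions *)

Section cmeasurable.
Context {R : realType}.
Implicit Types f g : R -> R[i].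

Lemma cmeasurable_cst (z : R[i]) : cmeasurable (fun _ : R => z).
Proof. by split; exact: measurable_cst. Qed.

Lemma cmeasurableD f g : cmeasurable f -> cmeasurable g ->
  cmeasurable (fun x => f x + g x).
Proof.
have [ReD ImD] : (forall z w : R[i], complex.Re (z + w) = complex.Re z + complex.Re w)
    /\ (forall z w : R[i], complex.Im (z + w) = complex.Im z + complex.Im w).
  by split=> -[? ?] [? ?].
move=> [mRf mIf] [mRg mIg]; split.
  by under eq_fun do rewrite ReD; exact: measurable_funD.
by under eq_fun do rewrite ImD; exact: measurable_funD.
Qed.

Lemma cmeasurableM f g : cmeasurable f -> cmeasurable g ->
  cmeasurable (fun x => f x * g x).
Proof.
have [ReM ImM] : (forall z w : R[i], complex.Re (z * w) =
      complex.Re z * complex.Re w - complex.Im z * complex.Im w) /\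
    (forall z w : R[i], complex.Im (z * w) =
      complex.Re z * complex.Im w + complex.Im z * complex.Re w).
  by split=> -[? ?] [? ?].
move=> [mRf mIf] [mRg mIg]; split.
  under eq_fun do rewrite ReM.
  by apply: measurable_funB; exact: measurable_funM.
under eq_fun do rewrite ImM.
by apply: measurable_funD; exact: measurable_funM.
Qed.

End cmeasurable.

(** * The norm and the operations on functions *)

Section amalgam_norm.
Context {R : realType} (b : R) (b_gt0 : 0 < b).
Local Notation mu := (@lebesgue_measure R).
Implicit Types (f g : R -> R[i]) (s t : R).

Definition samples f (x : R) : int -> R[i] := fun k => f (x - k%:~R / b).

Lemma l2sq_samples_shift f x (m : int) :
  l2sq (samples f (x - m%:~R / b)) = l2sq (samples f x).
Proof.
rewrite [RHS]/l2sq (@reindex_esum _ _ _ setT setT (fun k => m + k)).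
  apply: eq_esum => k _; congr (normc (f _) ^+ 2)%:E.
  by rewrite rmorphD mulrDl /=; ring.
split=> //= [k k' _ _ /addrI//|k _]; by exists (k - m); rewrite // addrC subrK.
Qed.

Lemma amalgam_normsq_le f (y : \bar R) : (amalgam_normsq b f <= y)%E <->
  {ae mu, forall x, (l2sq (samples f x) <= y)%E}.
Proof.
split=> [/ess_supP|] fy.
  apply: (@ae_periodic _ b (fun x => (l2sq (samples f x) <= y)%E) b_gt0 _ fy).
  by move=> x k; rewrite l2sq_samples_shift.
by apply/ess_supP; exact: ae_restr fy.
Qed.

(** Finiteness matters because [fine] sends [+oo] to 0, which would make the left side hold
    trivially. A negative or [-oo] essential supremum is not ruled out here: both sides are then
    true, the square root being 0. *)
Lemma amalgam_norm_le f s : 0 <= s -> (amalgam_normsq b f < +oo)%E ->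
  amalgam_norm b f <= s <->
  {ae mu, forall x, (l2sq (samples f x) <= (s ^+ 2)%:E)%E}.
Proof.
move=> s0 foo; rewrite -amalgam_normsq_le /amalgam_norm.
case: (amalgam_normsq b f) foo => [r _|//|_] /=.
  rewrite lee_fin; have [r0|r0] := leP 0 r.
    by rewrite -{1}[s]ger0_norm// -sqrtr_sqr ler_sqrt// sqr_ge0.
  by rewrite ler0_sqrtr ?(ltW r0)// s0 (le_trans (ltW r0))// sqr_ge0.
by rewrite sqrtr0 s0 leNye.
Qed.

Lemma amalgam_setP f s : cmeasurable f ->
  {ae mu, forall x, (l2sq (samples f x) <= (s ^+ 2)%:E)%E} ->
  f \in amalgam_set b.
Proof.
move=> mf /amalgam_normsq_le fs; rewrite inE; split => //.
by apply: le_lt_trans fs _; rewrite ltry.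
Qed.

Lemma amalgam_norm_ge0 f : 0 <= amalgam_norm b f.
Proof. exact: sqrtr_ge0. Qed.

Lemma amalgam_fun_lty (f : amalgam_fun b) : (amalgam_normsq b (val f) < +oo)%E.
Proof. by have := valP f; rewrite inE => -[]. Qed.

Lemma amalgam_fun_cmeasurable (f : amalgam_fun b) : cmeasurable (val f).
Proof. by have := valP f; rewrite inE => -[]. Qed.

Lemma l2sq_samples_amalgam (f : amalgam_fun b) s :
  amalgam_norm b (val f) <= s ->
  {ae mu, forall x, (l2sq (samples (val f) x) <= (s ^+ 2)%:E)%E}.
Proof.
move=> fs; apply/amalgam_norm_le => //.
  exact: le_trans (amalgam_norm_ge0 _) fs.
exact: amalgam_fun_lty.
Qed.

Lemma amalgam_norm_fun_le (f : amalgam_fun b) s : 0 <= s ->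
  {ae mu, forall x, (l2sq (samples (val f) x) <= (s ^+ 2)%:E)%E} ->
  amalgam_norm b (val f) <= s.
Proof. by move=> s0 ?; apply/(amalgam_norm_le s0 (amalgam_fun_lty f)). Qed.

(** Makes the norm well defined on classes: outside one null set, [f] and [g] agree at all the
    countably many translates of [x], so their samples coincide. *)
Lemma amalgam_norm_ae (f g : amalgam_fun b) :
  {ae mu, forall x, val f x = val g x} ->
  amalgam_norm b (val f) = amalgam_norm b (val g).
Proof.
have le (f' g' : amalgam_fun b) : {ae mu, forall x, val f' x = val g' x} ->
    amalgam_norm b (val f') <= amalgam_norm b (val g').
  move=> fg; apply: amalgam_norm_fun_le (amalgam_norm_ge0 _) _.
  apply: ae_imply2 (ae_shifts b fg) (l2sq_samples_amalgam (lexx _)) => x fgx.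
  have -> : samples (val f') x = samples (val g') x; last exact: id.
  by apply: funext => k; exact: fgx.
move=> fg; apply/eqP; rewrite eq_le !le//.
by apply: ae_imply fg => x ->.
Qed.

Lemma amalgam_norm_eq0 (f : amalgam_fun b) :
  amalgam_norm b (val f) = 0 -> {ae mu, forall x, val f x = 0}.
Proof.
move=> f0; have fle0 : amalgam_norm b (val f) <= 0 by rewrite f0.
(* The sample with index 0 is the value at [x] itself. *)
apply: ae_imply (l2sq_samples_amalgam fle0) => x /(@l2sq_normc _ _ _ _ 0).
rewrite /samples mul0r subr0 => /(_ (lexx _)) fx0.
apply: ComplexField.Normc.eq0_normc; apply/eqP.
by rewrite eq_le fx0 normc_ge0.
Qed.

(** The slack [e] makes the bound strictly positive, as [l2sqD] requires, even when the norm is 0;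
    [amalgam_normD] removes it by letting [e] be arbitrary. *)
Lemma amalgam_bound (f : amalgam_fun b) e : 0 < e ->
  {ae mu, forall x,
    (l2sq (samples (val f) x) <= ((amalgam_norm b (val f) + e) ^+ 2)%:E)%E}.
Proof. by move=> e0; apply: l2sq_samples_amalgam; rewrite lerDl ltW. Qed.

Lemma l2sq_samplesD (f g : amalgam_fun b) e : 0 < e ->
  {ae mu, forall x, (l2sq (samples (fun y => (val f y + val g y)%R) x) <=
    ((amalgam_norm b (val f) + amalgam_norm b (val g) + e) ^+ 2)%R%:E)%E}.
Proof.
move=> e0; have e20 : 0 < e / 2 by rewrite divr_gt0.
apply: ae_imply2 (amalgam_bound f e20) (amalgam_bound g e20) => x fx gx.
have := l2sqD _ _ fx gx; rewrite addrACA -splitr; apply.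
  by rewrite ltr_wpDl// amalgam_norm_ge0.
by rewrite ltr_wpDl// amalgam_norm_ge0.
Qed.

Lemma amalgam_setD (f g : amalgam_fun b) :
  (fun x => val f x + val g x) \in amalgam_set b.
Proof.
apply: amalgam_setP (l2sq_samplesD f g ltr01).
by apply: cmeasurableD; exact: amalgam_fun_cmeasurable.
Qed.

Definition amalgam_fun_add (f g : amalgam_fun b) : amalgam_fun b :=
  exist (fun h => h \in amalgam_set b) _ (amalgam_setD f g).

Lemma amalgam_normD (f g : amalgam_fun b) :
  amalgam_norm b (val (amalgam_fun_add f g)) <=
  amalgam_norm b (val f) + amalgam_norm b (val g).
Proof.
apply/ler_addgt0Pr => e e0.
apply: (@amalgam_norm_fun_le (amalgam_fun_add f g)); last exact: l2sq_samplesD.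
by rewrite !addr_ge0 ?amalgam_norm_ge0// ltW.
Qed.

Lemma l2sq_samplesZ (a : R[i]) (f : amalgam_fun b) :
  {ae mu, forall x, (l2sq (samples (fun y => (a * val f y)%R) x) <=
    ((normc a * amalgam_norm b (val f)) ^+ 2)%R%:E)%E}.
Proof.
by apply: ae_imply (l2sq_samples_amalgam (lexx _)) => x; exact: l2sqZ.
Qed.

Lemma amalgam_setZ (a : R[i]) (f : amalgam_fun b) :
  (fun x => a * val f x) \in amalgam_set b.
Proof.
apply: amalgam_setP (l2sq_samplesZ a f).
by apply: cmeasurableM; [exact: cmeasurable_cst|exact: amalgam_fun_cmeasurable].
Qed.

Definition amalgam_fun_scale a (f : amalgam_fun b) : amalgam_fun b :=
  exist (fun h => h \in amalgam_set b) _ (amalgam_setZ a f).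

Lemma amalgam_normZ_le a (f : amalgam_fun b) :
  amalgam_norm b (val (amalgam_fun_scale a f)) <=
  normc a * amalgam_norm b (val f).
Proof.
apply: (@amalgam_norm_fun_le (amalgam_fun_scale a f)); last first.
  exact: l2sq_samplesZ.
by rewrite mulr_ge0 ?normc_ge0 ?amalgam_norm_ge0.
Qed.

Lemma amalgam_normZ a (f : amalgam_fun b) :
  amalgam_norm b (val (amalgam_fun_scale a f)) =
  normc a * amalgam_norm b (val f).
Proof.
apply/eqP; rewrite eq_le amalgam_normZ_le/=.
have [->|a0] := eqVneq a 0.
  by rewrite ComplexField.Normc.normc0 mul0r amalgam_norm_ge0.
have a_gt0 : 0 < normc a.
  rewrite lt_neqAle normc_ge0 andbT eq_sym; apply: contra a0 => /eqP.
  by move=> /ComplexField.Normc.eq0_normc ->.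
(* The reverse inequality is the one already proved, applied to [a^-1] and [a * f], whose product is
   [f]. *)
rewrite -ler_pdivlMl// -ComplexField.Normc.normcV.
apply: le_trans (amalgam_normZ_le a^-1 (amalgam_fun_scale a f)).
rewrite le_eqVlt; apply/orP; left; apply/eqP; apply: amalgam_norm_ae.
by apply: aeW => x /=; rewrite mulKf.
Qed.

Lemma l2sq_samplesM (f g : amalgam_fun b) :
  {ae mu, forall x, (l2sq (samples (fun y => (val f y * val g y)%R) x) <=
    ((amalgam_norm b (val f) * amalgam_norm b (val g)) ^+ 2)%R%:E)%E}.
Proof.
apply: ae_imply2 (l2sq_samples_amalgam (lexx _)) (l2sq_samples_amalgam (lexx _)).
by move=> x; apply: l2sqM; exact: amalgam_norm_ge0.
Qed.

Lemma amalgam_setM (f g : amalgam_fun b) :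
  (fun x => val f x * val g x) \in amalgam_set b.
Proof.
apply: amalgam_setP (l2sq_samplesM f g).
by apply: cmeasurableM; exact: amalgam_fun_cmeasurable.
Qed.

Definition amalgam_fun_mul (f g : amalgam_fun b) : amalgam_fun b :=
  exist (fun h => h \in amalgam_set b) _ (amalgam_setM f g).

Lemma amalgam_normM (f g : amalgam_fun b) :
  amalgam_norm b (val (amalgam_fun_mul f g)) <=
  amalgam_norm b (val f) * amalgam_norm b (val g).
Proof.
apply: (@amalgam_norm_fun_le (amalgam_fun_mul f g)); last exact: l2sq_samplesM.
by rewrite mulr_ge0// amalgam_norm_ge0.
Qed.

Lemma amalgam_set0 : (fun=> 0) \in amalgam_set b.
Proof.
apply: (@amalgam_setP _ 0 (cmeasurable_cst 0)).
apply: aeW => x; rewrite /l2sq esum1// => k _.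
by rewrite /samples ComplexField.Normc.normc0 expr0n.
Qed.

Definition amalgam_fun0 : amalgam_fun b := 
  exist (fun h => h \in amalgam_set b) _ amalgam_set0.

End amalgam_norm.

(** * Completeness at the level of functions *)

Section completeness.
Context {R : realType}.
Local Notation mu := (@lebesgue_measure R).

Lemma exists_exprn_half (e : R) : 0 < e -> exists n : nat, 2^-1 ^+ n < e.
Proof.
move=> e0; have : (2^-1 : R) ^+ n @[n --> \oo] --> (0 : R).
  by apply: cvg_expr; rewrite ger0_norm// invf_lt1 ?ltr1n.
move=> /cvgr0_norm_lt /(_ e e0) [n _ /(_ n (leqnn n))] ne.
by exists n; rewrite (le_lt_trans (ler_norm _)).
Qed.

Lemma cvg_geometric_cauchy (v : nat -> R) :
  (forall n m, (n <= m)%N -> `|v m - v n| <= 2^-1 ^+ n) -> cvgn v.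
Proof.
move=> vP; apply/cauchy_cvgP/cauchy_exP => e e0.
have [n ne] := exists_exprn_half e0.
exists (v n); exists n => // m /= nm.
by rewrite -ball_normE /= distrC (le_lt_trans (vP _ _ nm)).
Qed.

(** A limsup is measurable whether or not the sequence converges, so no exceptional set has to be
    cut out; [fine] sends infinite values to 0. *)
Definition limsup_fun (u : nat -> R -> R) (x : R) : R :=
  fine (limn_esup (fun n => (u n x)%:E)).

Lemma limsup_fun_cvg (u : nat -> R -> R) x :
  cvgn (u ^~ x) -> u n x @[n --> \oo] --> limsup_fun u x.
Proof.
move=> ux; rewrite /limsup_fun.
have uxE : (u n x)%:E @[n --> \oo] --> (limn (u ^~ x))%:E.
  by apply: cvg_EFin => //; exact: nearW.
rewrite is_cvg_limn_esupE; first by rewrite (cvg_lim _ uxE).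
by apply/cvg_ex; eexists; exact: uxE.
Qed.

Lemma measurable_limsup_fun (u : nat -> R -> R) :
  (forall n,
    measurable_fun [set: lebesgueTypeR R] (u n : lebesgueTypeR R -> R)) ->
  measurable_fun [set: lebesgueTypeR R] (limsup_fun u : lebesgueTypeR R -> R).
Proof.
move=> mu_; apply: measurableT_comp; first exact: fine_measurable.
by apply: measurable_fun_limn_esup => n; exact/measurable_EFinP.
Qed.

(** The geometric rate is assumed from the start, so no subsequence has to be extracted here. *)
Lemma amalgam_riesz_fischer (b : R) (u : nat -> amalgam_fun b) : 0 < b ->
  (forall n m, (n <= m)%N -> {ae mu, forall x,
    (l2sq (samples b (fun y => (val (u m) y - val (u n) y)%R) x) <=
     ((2^-1 ^+ n) ^+ 2)%:E)%E}) ->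
  exists l : amalgam_fun b, forall n, {ae mu, forall x,
    (l2sq (samples b (fun y => (val l y - val (u n) y)%R) x) <=
     ((2^-1 ^+ n) ^+ 2)%:E)%E}.
Proof.
move=> b0 uP.
have [ReB ImB] : (forall z w : R[i], complex.Re (z - w) = complex.Re z - complex.Re w)
    /\ (forall z w : R[i], complex.Im (z - w) = complex.Im z - complex.Im w).
  by split=> -[? ?] [? ?].
have Re_le (z : R[i]) : `|complex.Re z| <= normc z.
  by rewrite -lecR; exact: normc_ge_Re.
have Im_le (z : R[i]) : `|complex.Im z| <= normc z.
  case: z => x y /=; rewrite -sqrtr_sqr ler_sqrt ?lerDr ?sqr_ge0//.
  by rewrite addr_ge0 ?sqr_ge0.
pose f y := limsup_fun (fun n y => complex.Re (val (u n) y)) y +i*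
            limsup_fun (fun n y => complex.Im (val (u n) y)) y.
have mf : cmeasurable f.
  split; apply: measurable_limsup_fun => n.
    by have [] := amalgam_fun_cmeasurable (u n).
  by have [] := amalgam_fun_cmeasurable (u n).
(* A single null set serves all pairs [n], [m]. *)
have uae : {ae mu, forall x, forall n m, (n <= m)%N ->
    (l2sq (samples b (fun y => (val (u m) y - val (u n) y)%R) x) <=
     ((2^-1 ^+ n) ^+ 2)%:E)%E}.
  apply: ae_foralln => n; apply: ae_foralln => m.
  have [nm|mn] := leqP n m; last exact: aeW.
  by apply: ae_imply (uP n m nm) => x.
have fP : {ae mu, forall x, forall n,
    (l2sq (samples b (fun y => (f y - val (u n) y)%R) x) <=
     ((2^-1 ^+ n) ^+ 2)%:E)%E}.
  apply: ae_imply uae => x ux n.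
  (* Each sample is bounded by the l^2 norm, so the sequence is Cauchy at every translate of [x]. *)
  have uk k n' m : (n' <= m)%N ->
      normc (val (u m) (x - k%:~R / b) - val (u n') (x - k%:~R / b)) <= 2^-1 ^+ n'.
    by move=> /(ux n' m) /(l2sq_normc k); apply; rewrite exprn_ge0// invr_ge0.
  apply: (@l2sq_lim _ _ (fun m => samples b (fun y => val (u m) y - val (u n) y) x)).
  - move=> k; rewrite /samples ReB; under eq_fun do rewrite ReB.
    apply: cvgB; last exact: cvg_cst.
    apply: limsup_fun_cvg; apply: cvg_geometric_cauchy => n' m nm.
    by rewrite -ReB (le_trans (Re_le _))// uk.
  - move=> k; rewrite /samples ImB; under eq_fun do rewrite ImB.
    apply: cvgB; last exact: cvg_cst.
    apply: limsup_fun_cvg; apply: cvg_geometric_cauchy => n' m nm.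
    by rewrite -ImB (le_trans (Im_le _))// uk.
  - by exists n => // m /= nm; exact: ux.
(* It remains to see that [f] lies in the space. The case [n = 0] bounds [f - u 0] by 1, and [f] is
   the sum of this difference and [u 0]. *)
have f0 : {ae mu, forall x,
    (l2sq (samples b (fun y => (f y - val (u 0%N) y)%R) x) <= (1 ^+ 2)%:E)%E}.
  by apply: ae_imply fP => x /(_ 0%N); rewrite expr0.
have fmu0 : (fun y => f y - val (u 0%N) y) \in amalgam_set b.
  apply: (amalgam_setP b0 _ f0); apply: cmeasurableD => //.
  have := cmeasurableM (@cmeasurable_cst R (-1)) (amalgam_fun_cmeasurable (u 0%N)).
  by under eq_fun do rewrite mulN1r.
have := amalgam_setD b0 (exist (fun h => h \in amalgam_set b) _ fmu0) (u 0%N).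
under eq_fun do rewrite /= subrK.
move=> fin; exists (exist (fun h => h \in amalgam_set b) _ fin) => n.
by apply: ae_imply fP => x.
Qed.

End completeness.

(** * Classes modulo almost everywhere equality *)

Section amalgam_class.
Context {R : realType} (b : R).
Local Notation mu := (@lebesgue_measure R).

Definition cls (f : amalgam_fun b) : amalgam b := \pi_(amalgam b) f.

Lemma cls_eqP (f g : amalgam_fun b) :
  cls f = cls g <-> {ae mu, forall x, val f x = val g x}.
Proof.
split=> [/eqquotP /asboolP fg|fg]; first by apply: ae_imply fg => x; exact.
by apply/eqquotP/asboolP; apply: ae_imply fg => x.
Qed.

Lemma cls_ext (f g : amalgam_fun b) : (forall x, val f x = val g x) ->
  cls f = cls g.
Proof. by move=> fg; apply/cls_eqP; exact: aeW. Qed.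

Lemma clsK (u : amalgam b) : cls (repr u) = u.
Proof. exact: reprK. Qed.

Lemma repr_cls (f : amalgam_fun b) :
  {ae mu, forall x, val (repr (cls f)) x = val f x}.
Proof. by apply/cls_eqP; rewrite clsK. Qed.

End amalgam_class.

(* The operations need [0 < b], so the structures are attached to a copy of
   [amalgam b] indexed by a proof of it. *)
Definition amalgam_alg (R : realType) (b : R) (b_gt0 : 0 < b) : Type :=
  amalgam b.

(** * The Banach algebra structure on classes *)

Section amalgam_algebra.
Context {R : realType} (b : R) (b_gt0 : 0 < b).
Local Notation mu := (@lebesgue_measure R).
Local Notation V := (amalgam_alg b_gt0).
Local Notation cls := (@cls R b : amalgam_fun b -> V).
Implicit Types (u v w : V) (f g h : amalgam_fun b) (a c : R[i]).

HB.instance Definition _ := Choice.copy V (amalgam b).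

Lemma algW (P : V -> Prop) : (forall f, P (cls f)) -> forall u, P u.
Proof. by move=> Pf u; rewrite -[u](clsK (b := b)). Qed.

(** The operations act on chosen representatives; the lemmas from [alg_addE] to [alg_normE] show
    that the choice is immaterial, and the algebraic laws then hold pointwise. *)
Definition alg_add u v : V := cls (amalgam_fun_add b_gt0 (repr u) (repr v)).
Definition alg_scale a u : V := cls (amalgam_fun_scale b_gt0 a (repr u)).
Definition alg_mul u v : V := cls (amalgam_fun_mul b_gt0 (repr u) (repr v)).
(** In a normed module over [R[i]] the norm takes its values in [R[i]], hence the embedding of the
    real norm. *)
Definition alg_norm u : R[i] := (amalgam_norm b (val (repr u)))%:C.

Lemma alg_addE f g : alg_add (cls f) (cls g) = cls (amalgam_fun_add b_gt0 f g).
Proof.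
apply/cls_eqP; apply: ae_imply2 (repr_cls f) (repr_cls g) => x fx gx.
by rewrite /= fx gx.
Qed.

Lemma alg_scaleE a f : alg_scale a (cls f) = cls (amalgam_fun_scale b_gt0 a f).
Proof. by apply/cls_eqP; apply: ae_imply (repr_cls f) => x /= ->. Qed.

Lemma alg_mulE f g : alg_mul (cls f) (cls g) = cls (amalgam_fun_mul b_gt0 f g).
Proof.
apply/cls_eqP; apply: ae_imply2 (repr_cls f) (repr_cls g) => x fx gx.
by rewrite /= fx gx.
Qed.

Lemma alg_normE f : alg_norm (cls f) = (amalgam_norm b (val f))%:C.
Proof. by congr (_%:C); apply: amalgam_norm_ae => //; exact: repr_cls. Qed.

Let alg_addA : associative alg_add.
Proof.
elim/algW=> f; elim/algW=> g; elim/algW=> h; rewrite !alg_addE.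
by apply: cls_ext => x /=; rewrite addrA.
Qed.

Let alg_addC : commutative alg_add.
Proof.
elim/algW=> f; elim/algW=> g; rewrite !alg_addE.
by apply: cls_ext => x /=; rewrite addrC.
Qed.

Let alg_add0 : left_id (cls (amalgam_fun0 b_gt0)) alg_add.
Proof. by elim/algW=> f; rewrite alg_addE; apply: cls_ext => x /=; rewrite add0r. Qed.

Let alg_addN : left_inverse (cls (amalgam_fun0 b_gt0)) (alg_scale (-1)) alg_add.
Proof.
elim/algW=> f; rewrite alg_scaleE alg_addE.
by apply: cls_ext => x /=; rewrite mulN1r addNr.
Qed.

HB.instance Definition _ :=
  GRing.isZmodule.Build V alg_addA alg_addC alg_add0 alg_addN.

Lemma clsD f g : cls f + cls g = cls (amalgam_fun_add b_gt0 f g).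
Proof. exact: alg_addE. Qed.

Let alg_scaleA a c u : alg_scale a (alg_scale c u) = alg_scale (a * c) u.
Proof.
by elim/algW: u => f; rewrite !alg_scaleE; apply: cls_ext => x /=; rewrite mulrA.
Qed.

Let alg_scale1 : left_id 1 alg_scale.
Proof. by elim/algW=> f; rewrite alg_scaleE; apply: cls_ext => x /=; rewrite mul1r. Qed.

Let alg_scaleDr : right_distributive alg_scale +%R.
Proof.
move=> a; elim/algW=> f; elim/algW=> g.
by rewrite clsD !alg_scaleE clsD; apply: cls_ext => x /=; rewrite mulrDr.
Qed.

Let alg_scaleDl u : {morph alg_scale^~ u : a c / a + c}.
Proof.
move=> a c; elim/algW: u => f;
by rewrite !alg_scaleE clsD; apply: cls_ext => x /=; rewrite mulrDl.
Qed.

HB.instance Definition _ := GRing.Zmodule_isLmodule.Build R[i] V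
  alg_scaleA alg_scale1 alg_scaleDr alg_scaleDl.

Lemma clsZ a f : a *: cls f = cls (amalgam_fun_scale b_gt0 a f).
Proof. exact: alg_scaleE. Qed.

Let alg_normD u v : alg_norm (u + v) <= alg_norm u + alg_norm v.
Proof.
elim/algW: u => f; elim/algW: v => g;
by rewrite clsD !alg_normE -rmorphD lecR amalgam_normD.
Qed.

Let alg_normZ a u : alg_norm (a *: u) = `|a| * alg_norm u.
Proof.
elim/algW: u => f; rewrite clsZ !alg_normE.
by rewrite amalgam_normZ rmorphM.
Qed.

Let alg_norm_eq0 u : alg_norm u = 0 -> u = 0.
Proof.
elim/algW: u => f; rewrite alg_normE => /complexI f0.
by apply/cls_eqP; apply: ae_imply (amalgam_norm_eq0 b_gt0 f0) => x ->.
Qed.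

HB.instance Definition _ := Lmodule_isNormed.Build R[i] V
  alg_normD alg_normZ alg_norm_eq0.

Lemma norm_cls f : `|cls f| = (amalgam_norm b (val f))%:C.
Proof. exact: alg_normE. Qed.

Let alg_mulA : associative alg_mul.
Proof.
elim/algW=> f; elim/algW=> g; elim/algW=> h; rewrite !alg_mulE.
by apply: cls_ext => x /=; rewrite mulrA.
Qed.

Let alg_mulDl : left_distributive alg_mul +%R.
Proof.
elim/algW=> f; elim/algW=> g; elim/algW=> h.
by rewrite clsD !alg_mulE clsD; apply: cls_ext => x /=; rewrite mulrDl.
Qed.

Let alg_mulDr : right_distributive alg_mul +%R.
Proof.
elim/algW=> f; elim/algW=> g; elim/algW=> h.
by rewrite clsD !alg_mulE clsD; apply: cls_ext => x /=; rewrite mulrDr.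
Qed.

Let alg_scalerAl a u v : a *: alg_mul u v = alg_mul (a *: u) v.
Proof.
elim/algW: u => f; elim/algW: v => g.
by rewrite clsZ !alg_mulE clsZ; apply: cls_ext => x /=; rewrite mulrA.
Qed.

Let alg_scalerAr a u v : a *: alg_mul u v = alg_mul u (a *: v).
Proof.
elim/algW: u => f; elim/algW: v => g.
by rewrite clsZ !alg_mulE clsZ; apply: cls_ext => x /=; rewrite mulrCA.
Qed.

Let alg_normM u v : `|alg_mul u v| <= `|u| * `|v|.
Proof.
elim/algW: u => f; elim/algW: v => g.
by rewrite alg_mulE !norm_cls -rmorphM lecR amalgam_normM.
Qed.

(** A Cauchy filter contains balls of radius [2^-(n+2)]; their centres [w n] form a sequence with
    geometric rate, and the filter converges to the limit of that sequence. *)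
Let alg_complete (F : set_system V) : ProperFilter F -> cauchy F -> cvg F.
Proof.
move=> FF /cauchyP Fc.
have e_gt0 n : 0 < ((2^-1 ^+ n.+2)%:C : R[i]).
  by rewrite ltcR exprn_gt0// invr_gt0.
have /choice[w Fw] n : exists u, F (ball u (((2^-1 ^+ n.+2)%:C : R[i]))).
  exact: Fc (e_gt0 n).
have wP n m : (n <= m)%N -> `|w m - w n| <= (2^-1 ^+ n)%:C.
  (* Two members of a proper filter meet; a common point [z] gives distance at most
     [2^-(n+2) + 2^-(m+2)], which is below [2^-n]. *)
  move=> nm; have [z [/=]] := filter_ex (filterI (Fw n) (Fw m)).
  rewrite -!ball_normE /= => zn zm.
  apply: le_trans (ler_distD z _ _) _; rewrite (distrC z).
  apply: le_trans (lerD (ltW zm) (ltW zn)) _.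
  rewrite -rmorphD lecR !exprS.
  have : (2^-1 : R) ^+ m <= 2^-1 ^+ n.
    by rewrite ler_wiXn2l// invf_le1 ?ler1n.
  have : 0 <= (2^-1 : R) ^+ m by rewrite exprn_ge0.
  lra.
(* Translates between distances of classes and the pointwise bounds of [amalgam_riesz_fischer]. *)
have distE f g s : 0 <= s -> `|cls f - cls g| <= s%:C <->
    {ae mu, forall x, (l2sq (samples b (fun y => (val f y - val g y)%R) x) <=
      (s ^+ 2)%:E)%E}.
  move=> s0; rewrite -scaleN1r clsZ clsD norm_cls lecR.
  rewrite (amalgam_norm_le b_gt0 s0 (amalgam_fun_lty _)) /=.
  by under [X in samples b X]eq_fun do rewrite mulN1r.
have half_ge0 n : 0 <= (2^-1 : R) ^+ n by rewrite exprn_ge0.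
have wrP n m : (n <= m)%N -> {ae mu, forall x,
    (l2sq (samples b (fun y => (val (repr (w m)) y - val (repr (w n)) y)%R) x) <=
     ((2^-1 ^+ n) ^+ 2)%:E)%E}.
  by move=> nm; apply/distE => //; rewrite !clsK; exact: wP.
have [l lP] := amalgam_riesz_fischer b_gt0 wrP.
apply/cvg_ex; exists (cls l); apply/cvg_ballP => e e0.
(* The radius [e] is an element of [R[i]]; being positive, it is real. *)
have eE : (complex.Re e)%:C = e by rewrite RRe_real// gtr0_real.
(* The final distance is at most [2^-n + 2^-(n+2)], less than twice [2^-n], hence the factor 2. *)
have [n ne] : exists n : nat, 2^-1 ^+ n < complex.Re e / 2.
  by apply: exists_exprn_half; rewrite divr_gt0// -ltcR eE.
apply: filterS (Fw n) => y; rewrite -!ball_normE /= => wy.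
apply: le_lt_trans (ler_distD (w n) _ _) _.
have lw : `|cls l - w n| <= (2^-1 ^+ n)%:C.
  by rewrite -[w n](clsK (b := b)); apply/distE.
apply: lt_le_trans (ler_ltD lw wy) _.
rewrite -eE -rmorphD lecR !exprS; move: (half_ge0 n); lra.
Qed.

HB.instance Definition _ := Uniform_isComplete.Build V alg_complete.

HB.instance Definition _ := CompleteNormedModule_isBanachAlgebra.Build R[i] V
  alg_mulA alg_mulDl alg_mulDr alg_scalerAl alg_scalerAr alg_normM.

Lemma clsM f g : bmul (cls f) (cls g) = cls (amalgam_fun_mul b_gt0 f g).
Proof. exact: alg_mulE. Qed.

End amalgam_algebra.

(* c ranges over the Banach algebra structures on the type amalgam b; each
   exists2 h includes the closure of the space under the operation. *)
Theorem proposition4p1 (R : realType) (b : R) (hb : 0 < b) :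
  exists c : BanachAlgebra.axioms_ R[i] (amalgam b),
    let A : banachAlgType R[i] := BanachAlgebra.Pack c in
    let cls (f : amalgam_fun b) : A := \pi_(amalgam b) f in
    [/\ forall f g : amalgam_fun b,
          exists2 h : amalgam_fun b,
            forall x, val h x = val f x + val g x & cls h = cls f + cls g,
        forall (a : R[i]) (f : amalgam_fun b),
          exists2 h : amalgam_fun b,
            forall x, val h x = a * val f x & cls h = a *: cls f,
        forall f g : amalgam_fun b,
          exists2 h : amalgam_fun b,
            forall x, val h x = val f x * val g x & cls h = bmul (cls f) (cls g)
      & forall f : amalgam_fun b, `|cls f| = (amalgam_norm b (val f))%:C ].
Proof.
(* [amalgam_alg hb] unfolds to [amalgam b], so by conversion its structure is one on [amalgam b]. *)
exists (BanachAlgebra.class (amalgam_alg hb)); split => [f g|a f|f g|f].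
- by exists (amalgam_fun_add hb f g) => //; rewrite (clsD hb).
- by exists (amalgam_fun_scale hb a f) => //; rewrite (clsZ hb).
- by exists (amalgam_fun_mul hb f g) => //; rewrite (clsM hb).
- exact: (norm_cls hb).
Qed.
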